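(* Let $U\subseteq\mathbb H$ be an axially symmetric domain (connected open set) and let $f:U\to\mathbb H$ be a left slice hyperholomorphic function. Let $h=\bar Df$. If $q=u+I_{\underline q}v\in U\setminus\mathbb R$, where $u=q_0$, $v=|\underline q|$, $I_{\underline q}=\underline q/|\underline q|$, then for every $I\in\mathbb S$, setting $q_{\pm I}=u\pm Iv$, $$h(q)=\bar Df(q)=\Big[\tfrac{\partial}{\partial u}f(q_I)+\tfrac{\partial}{\partial u}f(q_{-I})\Big]+I_{\underline q}I\Big[\tfrac{\partial}{\partial u}f(q_{-I})-\tfrac{\partial}{\partial u}f(q_I)\Big]+(\underline q)^{-1}I_{\underline q}I\,[f(q_{-I})-f(q_I)].$$ If $q=u\in U\cap\mathbb R$, then $$h(u)=\bar Df(u)=4\,\frac{\partial}{\partial u}f(u).$$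
   Context: $\mathbb H$ denotes the quaternions $q=q_0+q_1e_1+q_2e_2+q_3e_3$ ($q_i\in\mathbb R$, $e_1^2=e_2^2=e_3^2=-1$, $e_1e_2=-e_2e_1=e_3$, $e_2e_3=-e_3e_2=e_1$, $e_3e_1=-e_1e_3=e_2$), $\underline q=q_1e_1+q_2e_2+q_3e_3$, $|q|$ is the Euclidean norm. $\mathbb S=\{\underline q: |\underline q|=1\}$, and $[q]=\{q_0+I|\underline q| : I\in\mathbb S\}$. A set $U\subseteq\mathbb H$ is axially symmetric if $[q]\subset U$ for all $q\in U$. Slice hyperholomorphic functions: let $U$ be an axially symmetric open set and $\mathcal U=\{(u,v)\in\mathbb R^2: u+\mathbb Sv\subset U\}$. A function $f:U\to\mathbb H$ is left slice hyperholomorphic if $f(u+Iv)=\alpha(u,v)+I\beta(u,v)$ for all $(u,v)\in\mathcal U$, $I\in\mathbb S$, with $C^1$ functions $\alpha,\beta:\mathcal U\to\mathbb H$ satisfying $\alpha(u,v)=\alpha(u,-v)$, $\beta(u,v)=-\beta(u,-v)$ and $\partial_u\alpha-\partial_v\beta=0$, $\partial_v\alpha+\partial_u\beta=0$. The conjugate Cauchy–Fueter operator is $\bar Df=\partial_{q_0}f-e_1\partial_{q_1}f-e_2\partial_{q_2}f-e_3\partial_{q_3}f$ (units multiplied on the left). $\frac{\partial}{\partial u}f(q_{\pm I})$ denotes the partial derivative in $u$ of $(u,v)\mapsto f(u\pm Iv)$. *)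

(* Defs.v *)
From HB Require Import structures.
From mathcomp Require Import all_boot all_order all_algebra.
From mathcomp Require Import all_classical all_reals all_analysis.
From mathcomp Require Import ring lra.

Set Implicit Arguments.
Unset Strict Implicit.
Unset Printing Implicit Defensive.

Import Order.TTheory GRing.Theory Num.Theory.
Import numFieldNormedType.Exports.

Local Open Scope classical_set_scope.
Local Open Scope ring_scope.

(* The quaternion q0 + q1 e1 + q2 e2 + q3 e3 is the row vector (q0 q1 q2 q3),
   from which it inherits its real vector space structure and its (Euclidean)
   topology.  The library norm `|q| of row vectors is the sup norm: the
   Euclidean norm is qnorm below. *)
Definition quat (R : realType) : Type := 'rV[R]_4.

HB.instance Definition _ (R : realType) :=
  NormedModule.copy (quat R) 'rV[R]_4.
HB.instance Definition _ (R : realType) := Complete.copy (quat R) 'rV[R]_4.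

Section Quaternions.
Variable R : realType.
Implicit Types p q : quat R.

Definition mkquat (a b c d : R) : quat R := \row_(i < 4) [:: a; b; c; d]`_i.

Definition qcoord q (i : 'I_4) : R := (q : 'rV[R]_4) 0 i.

Local Notation "q .#[ i ]" := (qcoord q i).

Lemma quatP p q : p.#[0] = q.#[0] -> p.#[1] = q.#[1] -> p.#[2] = q.#[2] ->
  p.#[3] = q.#[3] -> p = q.
Proof.
move=> h0 h1 h2 h3; apply/rowP => i.
have: i \in enum 'I_4 by rewrite mem_enum.
suff -> : enum 'I_4 = [:: 0; 1; 2; 3].
  by rewrite !inE => /or4P[] /eqP ->.
by apply: (inj_map val_inj); rewrite val_enum_ord.
Qed.

Lemma mkquatE a b c d : ((mkquat a b c d).#[0] = a) * ((mkquat a b c d).#[1] = b)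
  * ((mkquat a b c d).#[2] = c) * ((mkquat a b c d).#[3] = d).
Proof. by rewrite /qcoord !mxE. Qed.

Lemma qcoordD p q i : (p + q).#[i] = p.#[i] + q.#[i].
Proof. by rewrite /qcoord mxE. Qed.

Lemma qcoord0 i : (0 : quat R).#[i] = 0.
Proof. by rewrite /qcoord mxE. Qed.

Lemma qcoordZ (a : R) q i : (a *: q).#[i] = a * q.#[i].
Proof. by rewrite /qcoord mxE. Qed.

Definition mulq p q : quat R := mkquat
  (p.#[0] * q.#[0] - p.#[1] * q.#[1] - p.#[2] * q.#[2] - p.#[3] * q.#[3])
  (p.#[0] * q.#[1] + p.#[1] * q.#[0] + p.#[2] * q.#[3] - p.#[3] * q.#[2])
  (p.#[0] * q.#[2] + p.#[2] * q.#[0] + p.#[3] * q.#[1] - p.#[1] * q.#[3])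
  (p.#[0] * q.#[3] + p.#[3] * q.#[0] + p.#[1] * q.#[2] - p.#[2] * q.#[1]).

Definition oneq : quat R := mkquat 1 0 0 0.

Lemma mulqA : associative mulq.
Proof. by move=> x y z; apply: quatP; rewrite /mulq !mkquatE; ring. Qed.

Lemma mul1q : left_id oneq mulq.
Proof. by move=> x; apply: quatP; rewrite /mulq /oneq !mkquatE; ring. Qed.

Lemma mulq1 : right_id oneq mulq.
Proof. by move=> x; apply: quatP; rewrite /mulq /oneq !mkquatE; ring. Qed.

Lemma mulqDl : left_distributive mulq +%R.
Proof.
by move=> x y z; apply: quatP; rewrite !qcoordD /mulq !mkquatE !qcoordD; ring.
Qed.

Lemma mulqDr : right_distributive mulq +%R.
Proof.
by move=> x y z; apply: quatP; rewrite !qcoordD /mulq !mkquatE !qcoordD; ring.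
Qed.

Lemma oneq_neq0 : oneq != 0.
Proof.
apply/eqP => /(congr1 (fun q => q.#[0])); rewrite mkquatE qcoord0 => /eqP.
by rewrite oner_eq0.
Qed.

HB.instance Definition _ := GRing.Zmodule_isNzRing.Build (quat R)
  mulqA mul1q mulq1 mulqDl mulqDr oneq_neq0.

Lemma mulqE p q : p * q = mulq p q.
Proof. by []. Qed.

Lemma oneqE : 1 = oneq.
Proof. by []. Qed.

Lemma scaleqAl (a : R) p q : a *: (p * q) = (a *: p) * q.
Proof.
by apply: quatP; rewrite qcoordZ !mulqE /mulq !mkquatE !qcoordZ; ring.
Qed.

HB.instance Definition _ := GRing.Lmodule_isLalgebra.Build R (quat R) scaleqAl.

Lemma scaleqAr (a : R) p q : a *: (p * q) = p * (a *: q).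
Proof.
by apply: quatP; rewrite qcoordZ !mulqE /mulq !mkquatE !qcoordZ; ring.
Qed.

HB.instance Definition _ := GRing.Lalgebra_isAlgebra.Build R (quat R) scaleqAr.

Definition qnorm q : R :=
  Num.sqrt (q.#[0] ^+ 2 + q.#[1] ^+ 2 + q.#[2] ^+ 2 + q.#[3] ^+ 2).

Definition conjq q : quat R := mkquat q.#[0] (- q.#[1]) (- q.#[2]) (- q.#[3]).

Definition invq q : quat R := (qnorm q ^+ 2)^-1 *: conjq q.

Lemma sqr_qnorm q :
  qnorm q ^+ 2 = q.#[0] ^+ 2 + q.#[1] ^+ 2 + q.#[2] ^+ 2 + q.#[3] ^+ 2.
Proof. by rewrite sqr_sqrtr// !addr_ge0 ?sqr_ge0. Qed.

Lemma sqr_qnorm_neq0 q : q != 0 -> qnorm q ^+ 2 != 0.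
Proof.
apply: contra_neq; rewrite sqr_qnorm => /eqP.
rewrite !paddr_eq0 ?addr_ge0 ?sqr_ge0// !sqrf_eq0 -!andbA.
by case/and4P => /eqP ? /eqP ? /eqP ? /eqP ?; apply: quatP; rewrite qcoord0.
Qed.

Definition unitq : pred (quat R) := fun q => q != 0.

Lemma mulVq : {in unitq, left_inverse 1 invq *%R}.
Proof.
move=> q /sqr_qnorm_neq0; rewrite /invq -scaleqAl.
suff -> : conjq q * q = qnorm q ^+ 2 *: (1 : quat R).
  by move=> q0; rewrite scalerA mulVf// scale1r.
rewrite sqr_qnorm; apply: quatP;
  by rewrite qcoordZ mulqE oneqE /mulq /oneq /conjq !mkquatE; ring.
Qed.

Lemma mulqV : {in unitq, right_inverse 1 invq *%R}.
Proof.
move=> q /sqr_qnorm_neq0; rewrite /invq -scaleqAr.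
suff -> : q * conjq q = qnorm q ^+ 2 *: (1 : quat R).
  by move=> q0; rewrite scalerA mulVf// scale1r.
rewrite sqr_qnorm; apply: quatP;
  by rewrite qcoordZ mulqE oneqE /mulq /oneq /conjq !mkquatE; ring.
Qed.

Lemma unitqP p q : q * p = 1 /\ p * q = 1 -> unitq p.
Proof.
move=> [qp1 _]; apply/eqP => p0; move: qp1; rewrite p0 mulr0 => /esym/eqP.
by rewrite oner_eq0.
Qed.

Lemma invq_out : {in [predC unitq], invq =1 id}.
Proof.
move=> q; rewrite inE negbK => /eqP ->; apply: quatP;
by rewrite /invq qcoordZ /conjq !mkquatE !qcoord0 ?oppr0 mulr0.
Qed.

HB.instance Definition _ := GRing.NzRing_hasMulInverse.Build (quat R)
  mulVq mulqV unitqP invq_out.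

Definition e1 : quat R := mkquat 0 1 0 0.
Definition e2 : quat R := mkquat 0 0 1 0.
Definition e3 : quat R := mkquat 0 0 0 1.

Lemma quat_units :
  [/\ e1 * e1 = -1, e2 * e2 = -1, e3 * e3 = -1,
      e1 * e2 = e3 /\ e2 * e1 = - e3 &
      (e2 * e3 = e1 /\ e3 * e2 = - e1) /\ (e3 * e1 = e2 /\ e1 * e3 = - e2)].
Proof.
have N q i : (- q).#[i] = - q.#[i] by rewrite /qcoord mxE.
by split; do ?split; apply: quatP; rewrite ?N mulqE ?oneqE /mulq !mkquatE; ring.
Qed.

Definition qre q : R := q.#[0].
Definition qvec q : quat R := mkquat 0 q.#[1] q.#[2] q.#[3].

(* The real number a, as a quaternion, is a%:A = a *: 1. *)
Definition qsphere : set (quat R) := [set I | qre I = 0 /\ qnorm I = 1].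

Definition qreal : set (quat R) := range (fun a : R => a%:A).

Definition qclass q : set (quat R) :=
  [set (qre q)%:A + qnorm (qvec q) *: I | I in qsphere].

Definition axially_symmetric (U : set (quat R)) : Prop :=
  forall q, U q -> qclass q `<=` U.

Definition slice_domain (U : set (quat R)) : set (R * R) :=
  [set w | [set w.1%:A + w.2 *: I | I in qsphere] `<=` U].

Definition partial_u (g : R -> R -> quat R) (u v : R) : quat R :=
  derive1 (g^~ v) u.
Definition partial_v (g : R -> R -> quat R) (u v : R) : quat R :=
  derive1 (g u) v.

Definition C1_on (A : set (R * R)) (g : R -> R -> quat R) : Prop :=
  forall w, A w ->
    [/\ derivable (g^~ w.2) w.1 1, derivable (g w.1) w.2 1,
        {for w, continuous (fun z : R * R => partial_u g z.1 z.2)} &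
        {for w, continuous (fun z : R * R => partial_v g z.1 z.2)}].

(* f matters only on U, and alpha, beta only on slice_domain U, which is open
   when U is open and axially symmetric. *)
Definition left_slice_hyperholomorphic (U : set (quat R))
    (f : quat R -> quat R) : Prop :=
  exists alpha beta : R -> R -> quat R,
    [/\ C1_on (slice_domain U) alpha, C1_on (slice_domain U) beta,
        forall u v, slice_domain U (u, v) ->
          [/\ alpha u v = alpha u (- v), beta u v = - beta u (- v),
              partial_u alpha u v - partial_v beta u v = 0 &
              partial_v alpha u v + partial_u beta u v = 0] &
        forall u v I, slice_domain U (u, v) -> qsphere I ->
          f (u%:A + v *: I) = alpha u v + I * beta u v].

Definition conj_cauchy_fueter (f : quat R -> quat R) (q : quat R) : quat R :=
  'D_1 f q - e1 * 'D_e1 f q - e2 * 'D_e2 f q - e3 * 'D_e3 f q.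

Definition slice_partial_u (f : quat R -> quat R) (I : quat R) (u v : R) :
    quat R :=
  partial_u (fun s t => f (s%:A + t *: I)) u v.

End Quaternions.

(* Main.v *)
(* On U, f p = alpha(p0, |p_|) + (p_ / |p_|) beta(p0, |p_|), so each
   directional derivative of f involves only the partial derivatives of alpha
   and beta.  Off the real axis, the derivative along an imaginary e is
   <p_, e> X + e beta / v, with X independent of e and v = |p_|; since the sum of
   the e_i <p_, e_i> is p_ and p_ p_ = -v^2, the operator collapses to
     alpha_u + J beta_u - J alpha_v + beta_v + 2 beta / v,   J = p_ / v,
   and the Cauchy-Riemann equations turn this into
     2 alpha_u + 2 J beta_u + 2 beta / v.
   At a real point u, f (u + t e_i) = alpha(u, t) + e_i beta(u, t) for both
   signs of t, and beta(., 0) = 0, which gives alpha_u + 3 beta_v = 4 alpha_u. *)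

Require Import Defs.
From HB Require Import structures.
From mathcomp Require Import all_boot all_order all_algebra.
From mathcomp Require Import all_classical all_reals all_analysis.
From mathcomp Require Import ring.

Set Implicit Arguments.
Unset Strict Implicit.
Unset Printing Implicit Defensive.

Import Order.TTheory GRing.Theory Num.Theory.
Import numFieldNormedType.Exports.

Local Open Scope classical_set_scope.
Local Open Scope ring_scope.

(** * Directional derivatives in normed modules: product rule, lines, chain rule *)

Lemma is_derive_cvgP {K : realType} {V W : normedModType K} (f : V -> W)
    (x v : V) (l : W) :
  is_derive x v f l <-> h^-1 *: (f (h *: v + x) - f x) @[h --> 0^'] --> l.
Proof.
split=> [[fx <-]|fl]; first exact: fx.
by apply: DeriveDef; [apply/cvg_ex; exists l|exact: cvg_lim fl].
Qed.

Section Derivatives.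
Context {K : realType} {V W : normedModType K}.

(** Product rule from directional derivability alone: the limit of [k (h *: v + x)] comes from
    differentiability of [k] restricted to the line through [x] along [v]. *)
Lemma is_derive_scale (k : V -> K) (f : V -> W) (x v : V) (dk : K) (df : W) :
  is_derive x v k dk -> is_derive x v f df ->
  is_derive x v (fun y => k y *: f y) (k x *: df + dk *: f x).
Proof.
move=> kx fx; have kd := @ex_derive _ _ _ _ _ _ _ kx.
have kc : k (h *: v + x) @[h --> 0^'] --> k x.
  suff : {for 0, continuous (fun h : K => k (h *: v + x))}.
    by move=> /continuous_withinNx; rewrite scale0r add0r.
  exact/differentiable_continuous/derivable1_diffP/(derivable1P _ _ _).1.
move: kx fx => /is_derive_cvgP kx /is_derive_cvgP fx; apply/is_derive_cvgP.
rewrite (_ : (fun h : K => _) = fun h : K =>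
    k (h *: v + x) *: (h^-1 *: (f (h *: v + x) - f x)) +
    (h^-1 *: (k (h *: v + x) - k x)) *: f x).
  by apply: cvgD; [exact: cvgZ|apply: cvgZ => //; exact: cvg_cst].
apply/funext => h; rewrite scalerA [_ * h^-1]mulrC.
rewrite -scalerA -[X in _ = _ + X]scalerA.
by rewrite -scalerDr; congr (_ *: _); rewrite scalerBr scalerBl addrA subrK.
Qed.

(** Both difference quotients are the same function of [h]; this turns one-variable computations
    into the directional derivatives of the operator. *)
Lemma is_derive_line (f : V -> W) (p v : V) (u : K) (l : W) :
  is_derive u 1 (fun s : K => f (s *: v + p)) l -> is_derive (u *: v + p) v f l.
Proof.
move=> /is_derive_cvgP fl; apply/is_derive_cvgP.
rewrite (_ : (fun h : K => _) = fun h : K =>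
    h^-1 *: (f ((h *: 1 + u) *: v + p) - f (u *: v + p))) //.
by apply/funext => h; rewrite [h *: 1]mulr1 scalerDl addrA.
Qed.

Lemma is_derive1_compr (f : K -> W) (g : K -> K) (x : K) (df : W) (dg : K) :
  is_derive (g x) 1 f df -> is_derive x 1 g dg ->
  is_derive x 1 (fun y => f (g y)) (dg *: df).
Proof.
move=> [fd fdf] [gd gdg].
move/derivable1_diffP: (fd) => fd'; move/derivable1_diffP: (gd) => gd'.
apply: DeriveDef; first exact/derivable1_diffP/(differentiable_comp gd' fd').
rewrite -derive1E derive1E'; last exact: (differentiable_comp gd' fd').
rewrite (diff_comp gd' fd') /= (diff1E gd') (diff1E fd') !derive1E fdf gdg.
by rewrite scale1r.
Qed.

End Derivatives.

(** Expansion in the canonical basis leaves a finite sum of continuous coordinates times fixed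
    vectors. *)
Lemma linear_rV_continuous {K : realType} {W : normedModType K} n
  (f : 'rV[K]_n -> W) : linear f -> continuous f.
Proof.
move=> lf.
have fM := GRing.isLinear.Build _ _ _ _ f lf.
pose F : {linear 'rV[K]_n -> W} := HB.pack f fM.
have fE y : f y = \sum_(i < n) y 0 i *: f (delta_mx 0 i).
  rewrite -[f]/(F : _ -> _) {1}[y]row_sum_delta linear_sum.
  by apply: eq_bigr => i _; rewrite linearZ.
rewrite (funext fE).
apply: continuous_big => [|i _ x]; first exact: add_continuous.
exact: (@cvgZ K W _ (nbhs x) _ (fun y : 'rV[K]_n => y 0 i) (cst _) _ _
  (@coord_continuous K 1 n 0 i x) (cvg_cst _)).
Qed.

(** * Quaternion algebra, imaginary units and the norm of the vector part *)

Section QuatAlgebra.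
Context {R : realType}.
Implicit Types (p q I : quat R) (a v : R).

Lemma qcoordN q i : qcoord (- q) i = - qcoord q i.
Proof. by rewrite /qcoord mxE. Qed.

Definition qcoordE := (mulqE, oneqE, @mkquatE R, @qcoordD R, qcoordN,
  @qcoordZ R, @qcoord0 R).

Lemma qreE a v I : qre I = 0 -> qre (a%:A + v *: I) = a.
Proof. by rewrite /qre => I0; rewrite !qcoordE I0; ring. Qed.

Lemma qvecE a v I : qre I = 0 -> qvec (a%:A + v *: I) = v *: I.
Proof.
rewrite /qre => I0; apply: quatP; rewrite /qvec /oneq !qcoordE ?I0; ring.
Qed.

Lemma qre_qvec q : qre q *: 1 + qvec q = q.
Proof. by apply: quatP; rewrite /qvec /qre /oneq !qcoordE; ring. Qed.

Lemma qvec_re q : qre (qvec q) = 0.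
Proof. by rewrite /qre /qvec mkquatE. Qed.

Lemma qnormZ v q : qnorm (v *: q) = `|v| * qnorm q.
Proof.
by rewrite /qnorm !qcoordZ !exprMn -!mulrDr sqrtrM ?sqr_ge0// sqrtr_sqr.
Qed.

Lemma qnormN q : qnorm (- q) = qnorm q.
Proof. by rewrite /qnorm !qcoordN !sqrrN. Qed.

Lemma qnorm_eq0 q : (qnorm q == 0) = (q == 0).
Proof.
apply/eqP/eqP => [q0|->]; last first.
  by rewrite /qnorm !qcoord0 expr0n/= !addr0 sqrtr0.
by apply/eqP; apply/negP => /negP /sqr_qnorm_neq0; rewrite q0 expr0n eqxx.
Qed.

Lemma imaginary_sqr q : qre q = 0 -> q * q = - (qnorm q ^+ 2)%:A.
Proof.
rewrite /qre sqr_qnorm => q0.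
by apply: quatP; rewrite !qcoordE /mulq /oneq ?mkquatE q0; ring.
Qed.

Lemma qsphereN I : qsphere I -> qsphere (- I).
Proof.
by move=> [I0 I1]; split; rewrite ?qnormN// /qre qcoordN -/(qre I) I0 oppr0.
Qed.

Lemma qsphere_sqr I : qsphere I -> I * I = -1.
Proof. by move=> [I0 I1]; rewrite imaginary_sqr// I1 expr1n scale1r. Qed.

Lemma qsphere_normalize q : qvec q != 0 ->
  qsphere ((qnorm (qvec q))^-1 *: qvec q).
Proof.
move=> q0; split; first by rewrite /qre qcoordZ [qcoord _ _]qvec_re mulr0.
by rewrite qnormZ ger0_norm ?invr_ge0 ?sqrtr_ge0// mulVf// qnorm_eq0.
Qed.

Lemma qsphere_e : [/\ qsphere (e1 R), qsphere (e2 R) & qsphere (e3 R)].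
Proof.
by split; split; rewrite /qre /qnorm !mkquatE// !expr0n expr1n/= ?addr0 ?add0r
  sqrtr1.
Qed.

(** The bracketed terms have the shape of the derivatives of [f] along the three units. The [X]
    terms reassemble [qvec q], and each square of a unit contributes [- a *: Y]. *)
Lemma sum_unitsM q (a : R) (X Y : quat R) :
  e1 R * (qcoord q 1 *: X + a *: (e1 R * Y)) +
  e2 R * (qcoord q 2 *: X + a *: (e2 R * Y)) +
  e3 R * (qcoord q 3 *: X + a *: (e3 R * Y)) = qvec q * X - (3 * a) *: Y.
Proof.
have [u1 u2 u3 _ _] := quat_units R.
have -> : qvec q = qcoord q 1 *: e1 R + qcoord q 2 *: e2 R + qcoord q 3 *: e3 R.
  by apply: quatP; rewrite /qvec /e1 /e2 /e3 ?qcoordD ?qcoordZ ?mkquatE; ring.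
have -> : (3 * a) *: Y = a *: Y + a *: Y + a *: Y.
  by rewrite -!scalerDl; congr (_ *: _); ring.
rewrite !mulrDr -!scaleqAr !mulrA u1 u2 u3 !mulN1r !scalerN.
by rewrite !mulrDl -!scaleqAl !opprD [X in X + _]addrACA [LHS]addrACA.
Qed.

Lemma mulq_continuous p : continuous (fun q : quat R => p * q).
Proof.
apply: (@linear_rV_continuous R (quat R) 4) => a x y.
by rewrite mulrDr -scaleqAr.
Qed.

Lemma is_derive_mulq (V : normedModType R) p (f : V -> quat R) (x v : V) df :
  is_derive x v f df -> is_derive x v (fun y => p * f y) (p * df).
Proof.
move=> /is_derive_cvgP fx; apply/is_derive_cvgP.
rewrite (_ : (fun h : R => _) =
  (fun q => p * q) \o fun h : R => h^-1 *: (f (h *: v + x) - f x)).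
  by apply: continuous_cvg => //; exact: mulq_continuous.
by apply/funext => h /=; rewrite -scalerAr mulrBr.
Qed.

(** The squared norm along the line is the quadratic [P] in [h], with linear coefficient [2 * c] and
    constant term [v ^+ 2 > 0], so the square root is differentiable at 0. *)
Lemma is_derive_qnorm_qvec q (e : quat R) : qre e = 0 -> qvec q != 0 ->
  is_derive (0 : R) 1 (fun h : R => qnorm (qvec (h *: e + q)))
    ((qcoord q 1 * qcoord e 1 + qcoord q 2 * qcoord e 2 +
      qcoord q 3 * qcoord e 3) / qnorm (qvec q)).
Proof.
move=> e0 q0.
set v := qnorm (qvec q); set c := (X in X / _).
have v0 : 0 < v by rewrite lt_neqAle sqrtr_ge0 eq_sym qnorm_eq0 q0.
pose n := qcoord e 1 ^+ 2 + qcoord e 2 ^+ 2 + qcoord e 3 ^+ 2.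
pose P := fun h : R => n * h ^+ 2 + (2 * c * h + v ^+ 2).
have -> : (fun h : R => qnorm (qvec (h *: e + q))) = Num.sqrt \o P.
  apply/funext => h /=; congr Num.sqrt; rewrite /P /n /c sqr_qnorm.
  by rewrite /qvec !qcoordE; ring.
have P0 : P 0 = v ^+ 2 by rewrite /P expr0n /=; ring.
have dP : is_derive (0 : R) 1 P (2 * c).
  by apply: is_derive_eq; rewrite /= /GRing.scale /=; ring.
have -> : c / v = (2 * Num.sqrt (P 0))^-1 * (2 * c).
  by rewrite P0 sqrtr_sqr gtr0_norm//; field; rewrite gt_eqF.
apply: is_derive1_comp; apply: is_derive1_sqrt.
by rewrite P0 exprn_gt0.
Qed.

End QuatAlgebra.

(** * The slice domain and the directional derivatives of a slice function *)

Section SliceDomain.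
Context {R : realType} (U : set (quat R)).
Hypotheses (openU : open U) (symU : axially_symmetric U).
Implicit Types (p q I : quat R) (u v : R).

Lemma slice_domain_qclass p : U p -> slice_domain U (qre p, qnorm (qvec p)).
Proof. exact: symU. Qed.

(** Axial symmetry spreads one point to its whole sphere, of radius [|v|]; a negative [v] is
    absorbed by replacing [J] with [- J]. *)
Lemma slice_domain_mem u v I : qsphere I -> U (u%:A + v *: I) ->
  slice_domain U (u, v).
Proof.
move=> [I0 I1] /symU UI; have := UI.
rewrite /qclass qreE// qvecE// qnormZ I1 mulr1 => UJ _ [J SJ <-] /=.
apply: UJ => /=; have [v0|v0] := ger0P v; first by exists J.
by exists (- J); [exact: qsphereN|rewrite scalerN scaleNr opprK].
Qed.

Lemma near_line p q u : U (u *: q + p) -> \forall s \near u, U (s *: q + p).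
Proof.
move=> Up; have c : s *: q + p @[s --> u] --> u *: q + p.
  by apply: cvgD; [exact: scalel_continuous|exact: cvg_cst].
by apply: c; exact: open_nbhs_nbhs.
Qed.

(** Openness of [U] on the single slice of [e1] suffices, by [slice_domain_mem]. Near the point, [f]
    may then be replaced by its expression in [alpha] and [beta]. *)
Lemma slice_domain_near1 u v : slice_domain U (u, v) ->
  \forall s \near u, slice_domain U (s, v).
Proof.
have [e1S _ _] := @qsphere_e R.
move=> Uuv; have := @near_line (v *: e1 R) 1 u (Uuv _ _).
move=> /(_ (ex_intro2 _ _ (e1 R) e1S erefl)).
by apply: filterS => s /slice_domain_mem; exact.
Qed.

Lemma slice_domain_near2 u v : slice_domain U (u, v) ->
  \forall t \near v, slice_domain U (u, t).
Proof.
have [e1S _ _] := @qsphere_e R.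
move=> Uuv; have := @near_line u%:A (e1 R) v.
rewrite addrC => /(_ (Uuv _ (ex_intro2 _ _ (e1 R) e1S erefl))).
by apply: filterS => t; rewrite addrC => /slice_domain_mem; exact.
Qed.

Variables (f : quat R -> quat R) (alpha beta : R -> R -> quat R).
Hypotheses (alphaC1 : C1_on (slice_domain U) alpha)
  (betaC1 : C1_on (slice_domain U) beta).
Hypothesis fE : forall u v I, slice_domain U (u, v) -> qsphere I ->
  f (u%:A + v *: I) = alpha u v + I * beta u v.
Hypothesis betaN : forall u v, slice_domain U (u, v) ->
  beta u v = - beta u (- v).

Lemma slice_beta0 u : slice_domain U (u, 0) -> beta u 0 = 0.
Proof.
move=> /betaN; rewrite oppr0 => /eqP; rewrite -addr_eq0 -mulr2n -scaler_nat.
by rewrite scaler_eq0 pnatr_eq0/= => /eqP.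
Qed.

Lemma is_derive_partial_u g u v : C1_on (slice_domain U) g ->
  slice_domain U (u, v) -> is_derive u 1 (g^~ v) (partial_u g u v).
Proof.
by move=> gC /gC[gu _ _ _]; rewrite /partial_u derive1E; exact: derivableP.
Qed.

Lemma is_derive_partial_v g u v : C1_on (slice_domain U) g ->
  slice_domain U (u, v) -> is_derive v 1 (g u) (partial_v g u v).
Proof.
by move=> gC /gC[_ gv _ _]; rewrite /partial_v derive1E; exact: derivableP.
Qed.

Lemma is_derive_slice_u u v I : slice_domain U (u, v) -> qsphere I ->
  is_derive u 1 (fun s => f (s%:A + v *: I))
    (partial_u alpha u v + I * partial_u beta u v).
Proof.
move=> Uuv SI.
apply: (@near_eq_is_derive R R (quat R)
  (fun s => alpha s v + I * beta s v)).
  by have := slice_domain_near1 Uuv; apply: filterS => s Usv; rewrite fE.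
apply: is_deriveD; first exact: is_derive_partial_u.
by apply: is_derive_mulq; exact: is_derive_partial_u.
Qed.

Lemma is_derive_slice_v u v I : slice_domain U (u, v) -> qsphere I ->
  is_derive v 1 (fun t => f (u%:A + t *: I))
    (partial_v alpha u v + I * partial_v beta u v).
Proof.
move=> Uuv SI.
apply: (@near_eq_is_derive R R (quat R)
  (fun t => alpha u t + I * beta u t)).
  by have := slice_domain_near2 Uuv; apply: filterS => t Uut; rewrite fE.
apply: is_deriveD; first exact: is_derive_partial_v.
by apply: is_derive_mulq; exact: is_derive_partial_v.
Qed.

Lemma slice_partial_uE u v I : slice_domain U (u, v) -> qsphere I ->
  slice_partial_u f I u v = partial_u alpha u v + I * partial_u beta u v.
Proof.
move=> Uuv SI; rewrite /slice_partial_u /partial_u derive1E.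
exact: (@derive_val _ _ _ _ _ _ _ (is_derive_slice_u Uuv SI)).
Qed.

Lemma is_derive_slice_1 u v I : slice_domain U (u, v) -> qsphere I ->
  is_derive (u%:A + v *: I) 1 f (partial_u alpha u v + I * partial_u beta u v).
Proof. by move=> Uuv SI; apply: is_derive_line; exact: is_derive_slice_u. Qed.

Lemma is_derive_real_imaginary u I : U u%:A -> qsphere I ->
  is_derive (u%:A : quat R) I f (partial_v alpha u 0 + I * partial_v beta u 0).
Proof.
move=> Uu SI; have Uu0 : slice_domain U (u, 0).
  by apply: (slice_domain_mem SI); rewrite scale0r addr0.
rewrite -[u%:A]add0r -(scale0r I); apply: is_derive_line.
rewrite (_ : (fun s => _) = fun t => f (u%:A + t *: I)).
  exact: is_derive_slice_v.
by apply/funext => s; rewrite addrC.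
Qed.

(** Real points are covered too: there [beta] vanishes by oddness and kills the second summand,
    whatever the value of [0^-1]. The formula thus holds on all of [U], and can be differentiated
    without avoiding the real axis. *)
Lemma slice_expand p : U p ->
  f p = alpha (qre p) (qnorm (qvec p)) +
        (qnorm (qvec p))^-1 *: (qvec p * beta (qre p) (qnorm (qvec p))).
Proof.
move=> Up; have Up' := slice_domain_qclass Up.
have [p0|p0] := eqVneq (qvec p) 0.
  have [e1S _ _] := @qsphere_e R; have := fE Up' e1S.
  have v0 : qnorm (qvec p) = 0 by apply/eqP; rewrite qnorm_eq0 p0.
  move: Up'; rewrite v0 => Up'; rewrite slice_beta0//.
  have -> : 0 *: e1 R = qvec p by rewrite scale0r p0.
  by rewrite qre_qvec => ->; rewrite !mulr0 scaler0.
have v0 : qnorm (qvec p) != 0 by rewrite qnorm_eq0.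
have := fE Up' (qsphere_normalize p0).
by rewrite scalerA mulfV// scale1r qre_qvec => ->; rewrite scaleqAl.
Qed.

(** Moving along an imaginary [e] keeps the real part fixed, so [alpha] and [beta] vary only through
    the norm [r h], whose derivative at 0 is [c / v]. This puts [c] in front of every term but the
    one that differentiates the factor [qvec q + h *: e]. *)
Lemma is_derive_imaginary q e : U q -> qvec q != 0 -> qre e = 0 ->
  let u := qre q in let v := qnorm (qvec q) in
  let c := qcoord q 1 * qcoord e 1 + qcoord q 2 * qcoord e 2 +
           qcoord q 3 * qcoord e 3 in
  is_derive q e f
    (c *: (v^-1 *: partial_v alpha u v - v^-1 ^+ 3 *: (qvec q * beta u v)
           + v^-1 ^+ 2 *: (qvec q * partial_v beta u v))
     + v^-1 *: (e * beta u v)).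
Proof.
move=> Uq q0 e0 u v c.
have v0 : v != 0 by rewrite qnorm_eq0.
have Uuv : slice_domain U (u, v) := slice_domain_qclass Uq.
have dr := is_derive_qnorm_qvec e0 q0; rewrite -/c -/v in dr.
have da := is_derive_partial_v alphaC1 Uuv.
have db := is_derive_partial_v betaC1 Uuv.
rewrite -[q in is_derive q](add0r q) -[X in X + q](scale0r e).
apply: is_derive_line.
pose r h := qnorm (qvec (h *: e + q)).
apply: (@near_eq_is_derive R R (quat R) (fun h => alpha u (r h) +
  (r h)^-1 *: (qvec q * beta u (r h) + h *: (e * beta u (r h))))).
  have : U (0 *: e + q) by rewrite scale0r add0r.
  move/near_line; apply: filterS => h /slice_expand ->; rewrite -/(r h).
  have -> : qre (h *: e + q) = u.
    by rewrite /qre qcoordD qcoordZ [qcoord e 0]e0 mulr0 add0r.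
  have -> : qvec (h *: e + q) = qvec q + h *: e.
    move: e0; rewrite /qre => e0; apply: quatP;
    by rewrite /qvec ?qcoordD ?qcoordZ ?mkquatE ?qcoordD ?qcoordZ ?e0; ring.
  by rewrite mulrDl -scaleqAl.
have r0 : r 0 = v by rewrite /r scale0r add0r.
have comp (g : R -> R -> quat R) : is_derive v 1 (g u) (partial_v g u v) ->
    is_derive (0 : R) 1 (fun h => g u (r h)) ((c / v) *: partial_v g u v).
  rewrite -{1}r0 => dg.
  exact: (@is_derive1_compr R (quat R) (g u) r 0 _ _ dg dr).
have dar := comp _ da; have dbr := comp _ db.
have drV : is_derive (0 : R) 1 (fun h => (r h)^-1) (- v ^- 2 *: (c / v)).
  by rewrite -r0; apply: is_deriveV; rewrite ?r0.
(* The summand [h *: (e * beta u (r h))] contributes only [e * beta u v], since its factor [h]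
   vanishes at 0. *)
have := is_deriveD dar (is_derive_scale drV
  (is_deriveD (is_derive_mulq (qvec q) dbr)
    (is_derive_scale (is_derive_id (0 : R) 1) (is_derive_mulq e dbr)))).
move/is_derive_eq; apply.
rewrite fctE !scale0r r0 [0 + _]add0r addr0 scale1r -!scaleqAr.
(* With the quaternion products made opaque, the identity is real-linear in them and can be checked
   coordinatewise. *)
move: (qvec q * partial_v beta u v) (qvec q * beta u v) (partial_v alpha u v)
  (e * beta u v) => Z Y A E.
rewrite [_ *: (c / v)]/GRing.scale/=.
by apply: quatP; rewrite !(qcoordD, qcoordN, qcoordZ); field.
Qed.

End SliceDomain.

(** * The operator off the real axis, and the two formulas *)

Lemma mul_slice_diff (R : realType) (I J x y : quat R) : qsphere I ->
  J * I * ((x - I * y) - (x + I * y)) = J * (y + y).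
Proof.
move=> SI; rewrite addrAC opprD addrA subrr add0r -opprD -mulrDr mulrN.
by rewrite -mulrA [I * (I * _)]mulrA qsphere_sqr// mulN1r mulrN opprK.
Qed.

(** The coefficient [2 / v] is [3 / v], from the squares of the three units, less [1 / v], from the
    square of [qvec q] in the term with [v^-1 ^+ 3]. *)
Lemma conj_cauchy_fueter_qvec (R : realType) (U : set (quat R))
    (f : quat R -> quat R) (alpha beta : R -> R -> quat R) (q : quat R) :
  open U -> axially_symmetric U ->
  C1_on (slice_domain U) alpha -> C1_on (slice_domain U) beta ->
  (forall u v I, slice_domain U (u, v) -> qsphere I ->
    f (u%:A + v *: I) = alpha u v + I * beta u v) ->
  (forall u v, slice_domain U (u, v) -> beta u v = - beta u (- v)) ->
  U q -> qvec q != 0 ->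
  let u := qre q in let v := qnorm (qvec q) in let J := v^-1 *: qvec q in
  conj_cauchy_fueter f q =
    partial_u alpha u v + J * partial_u beta u v
    - J * partial_v alpha u v + partial_v beta u v + (2 / v) *: beta u v.
Proof.
move=> openU symU aC bC fE bN Uq q0 u v J.
have v0 : v != 0 by rewrite qnorm_eq0.
have Uuv := slice_domain_qclass symU Uq.
have SJ := qsphere_normalize q0.
have := is_derive_slice_1 openU symU aC bC fE Uuv SJ.
rewrite scalerA mulfV// scale1r qre_qvec => d1.
have de e := is_derive_imaginary openU symU aC bC fE bN Uq q0 (e := e).
have [[e10 _] [e20 _] [e30 _]] := @qsphere_e R.
rewrite /conj_cauchy_fueter (derive_val (is_derive := d1)).
rewrite (derive_val (is_derive := de _ e10)).
rewrite (derive_val (is_derive := de _ e20)).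
rewrite (derive_val (is_derive := de _ e30)) /e1 /e2 /e3 !mkquatE.
(* For [e] a basis unit, [c] is the matching coordinate of [q]; the three subtractions become minus
   one sum, with [a] equal to [v^-1]. *)
rewrite !mulr0 !mulr1 !addr0 !add0r -!addrA -!opprD !addrA sum_unitsM.
rewrite -/u -/v !mulrDr mulrN -!scaleqAr !mulrA imaginary_sqr ?qvec_re//.
rewrite -/v !mulNr -!scaleqAl !mul1r /J.
move: (qvec q * _) (partial_v beta u v) => Y B.
by apply: quatP; rewrite !(qcoordD, qcoordN, qcoordZ); field.
Qed.

Theorem theorem4p10 (R : realType) (U : set (quat R)) (f : quat R -> quat R) :
  open U -> connected U -> axially_symmetric U ->
  left_slice_hyperholomorphic U f ->
  let h := conj_cauchy_fueter f in
  (forall q : quat R, (U `\` @qreal R) q ->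
     let u := qre q in
     let v := qnorm (qvec q) in
     let Iq := v^-1 *: qvec q in
     forall I : quat R, @qsphere R I ->
       let q_I := u%:A + v *: I in
       let q_NI := u%:A - v *: I in
       h q =
         (slice_partial_u f I u v + slice_partial_u f (- I) u v)
         + Iq * I * (slice_partial_u f (- I) u v - slice_partial_u f I u v)
         + (qvec q)^-1 * Iq * I * (f q_NI - f q_I))
  /\
  (forall u : R, U u%:A -> h u%:A = 4 *: derive1 (fun s : R => f s%:A) u).
Proof.
move=> openU _ symU [alpha [beta [aC bC CR fE]]] h.
have bN u v : slice_domain U (u, v) -> beta u v = - beta u (- v).
  by move=> /CR[].
split=> [q [Uq nRq] u v J I SI q_I q_NI|u Uu].
  have q0 : qvec q != 0.
    apply/eqP => q0; apply: nRq; exists (qre q) => //.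
    by rewrite -[RHS]qre_qvec q0 addr0.
  have v0 : v != 0 by rewrite qnorm_eq0.
  have Uuv : slice_domain U (u, v) := slice_domain_qclass symU Uq.
  have [_ _ /subr0_eq auE /eqP] := CR _ _ Uuv.
  rewrite addr_eq0 => /eqP avE.
  rewrite /h (conj_cauchy_fueter_qvec openU symU aC bC fE bN)// -/u -/v -/J.
  have SN := qsphereN SI.
  (* The point [q_NI] lies over the same [(u, v)] with unit [- I], so every bracket is expressed by
     [x + I * y] and [x - I * y]. In the differences [I * I = -1] eliminates [I]. *)
  rewrite !(slice_partial_uE openU symU aC bC fE Uuv)// /q_NI -scalerN !fE//.
  rewrite !mulNr !mul_slice_diff// avE auE mulrN opprK.
  (* Being a unit unfolds to [q0]. The product [(qvec q)^-1 * J] is then the real number [v^-1], and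
     the last bracket gives [2 / v] times [beta u v]. *)
  have qU : qvec q \is a GRing.unit by [].
  rewrite /J -scalerAr mulVr//.
  rewrite -!scaleqAl mul1r !mulrDr.
  by apply: quatP; rewrite !(qcoordD, qcoordN, qcoordZ); field.
have Uu0 : slice_domain U (u, 0).
  have [S1 _ _] := @qsphere_e R.
  by apply: (slice_domain_mem symU S1); rewrite scale0r addr0.
(* Near [u] on the real axis [beta] is identically 0 by oddness. The second Cauchy-Riemann equation
   then gives [partial_v alpha u 0 = 0]. *)
have bu : partial_u beta u 0 = 0.
  rewrite /partial_u derive1E -(derive_cst (0 : quat R) u 1).
  apply: near_eq_derive.
  have := slice_domain_near1 openU symU Uu0.
  by apply: filterS => s /(slice_beta0 bN).
have [_ _ /subr0_eq auE /eqP] := CR _ _ Uu0.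
rewrite bu addr0 => /eqP av.
have [S1 S2 S3] := @qsphere_e R.
(* The real line is the case [v = 0] of the slice of [e1]. *)
have d0 : is_derive u 1 (fun s : R => f s%:A) (partial_u alpha u 0).
  have := is_derive_slice_u openU symU aC bC fE Uu0 S1.
  rewrite bu mulr0 addr0; congr is_derive; apply/funext => s.
  by rewrite scale0r addr0.
have d1 : is_derive (u%:A : quat R) 1 f (partial_u alpha u 0).
  have := is_derive_slice_1 openU symU aC bC fE Uu0 S1.
  by rewrite bu mulr0 addr0 scale0r addr0.
have de I (SI : qsphere I) :=
  is_derive_real_imaginary openU symU aC bC fE Uu SI.
rewrite derive1E (derive_val (is_derive := d0)).
rewrite /h /conj_cauchy_fueter (derive_val (is_derive := d1)).
rewrite (derive_val (is_derive := de _ S1)) (derive_val (is_derive := de _ S2)).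
rewrite (derive_val (is_derive := de _ S3)) av !add0r !mulrA !qsphere_sqr//.
by rewrite !mulN1r !opprK -auE; apply: quatP; rewrite !(qcoordD, qcoordZ); ring.
Qed.
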